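(* Let $(\mathbf{ctx},u,\dot u,\Sigma\dashv\Delta)$ be a plain dependent type theory with extensional $\Phi$-types given by functors $\Phi:\mathcal Y\to\mathcal U$, $\Psi:\mathcal X\to\dot{\mathcal U}$, $\Lambda:\mathcal X\to\mathcal Y$. Then the usual formation, introduction, elimination, $\beta$- and $\eta$-computation rules hold: (F) if $\Gamma\vdash Y\ \mathcal Y$ (an object $Y\in\mathcal Y$ over $\Gamma$), then $\Phi Y$ is a type over $\Gamma$; (I) if $\Gamma\vdash X\ \mathcal X$, then $\Psi X$ is a term over $\Gamma$ of type $\Phi\Lambda X$; (E) there is a functor $(-)\langle-\rangle:\mathcal Y\Sigma.\Phi\dot{\mathcal U}\to\mathcal X$ over $\mathbf{ctx}$ sending a pair $(Y,a)$ with $\Sigma a=\Phi Y$ to $Y\langle a\rangle$, and it is inverse to the functor $\Lambda\star\Psi:\mathcal X\to\mathcal Y\Sigma.\Phi\dot{\mathcal U}$, $X\mapsto(\Lambda X,\Psi X)$; ($\beta$) for every $X\in\mathcal X$, $\Psi X=\Psi\big((\Lambda X)\langle\Psi X\rangle\big)$; ($\eta$) for every $(Y,a)$ with $\Sigma a=\Phi Y$, $a=\Psi(Y\langle a\rangle)$.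
   Context: Plain dependent type theory (pDTT): a category $\mathbf{ctx}$ (with terminal object), fibrations $u:\mathcal U\to\mathbf{ctx}$ (types) and $\dot u:\dot{\mathcal U}\to\mathbf{ctx}$ (terms), a functor $\Sigma:\dot{\mathcal U}\to\mathcal U$ (typing) with $u\Sigma=\dot u$, and a right adjoint $\Delta:\mathcal U\to\dot{\mathcal U}$ of $\Sigma$ (not required to commute with the projections to $\mathbf{ctx}$), with unit and counit having cartesian components and $\Sigma,\Delta$ preserving cartesian morphisms. An object $A$ with $u(A)=\Gamma$ is a type over $\Gamma$; an object $a$ with $\dot u(a)=\Gamma$ and $\Sigma a=A$ is a term over $\Gamma$ of type $A$. Extensional $\Phi$-types: categories $\mathcal X,\mathcal Y$ and functors $\Lambda:\mathcal X\to\mathcal Y$ and $\mathcal Y\to\mathbf{ctx}$ (obtained by finite limits from the generating data), together with functors $\Phi:\mathcal Y\to\mathcal U$ over $\mathbf{ctx}$ and $\Psi:\mathcal X\to\dot{\mathcal U}$ such that $\Sigma\Psi=\Phi\Lambda$ and this square is a pullback of categories. $\mathcal X$ lies over $\mathbf{ctx}$ via $\Lambda$. $\mathcal Y\Sigma.\Phi\dot{\mathcal U}$ denotes the canonical pullback of $\Phi$ and $\Sigma$, with objects the pairs $(Y,a)$ such that $\Phi Y=\Sigma a$. *)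

(* Defs.v *)
(* Self-contained development over Stdlib.  Equality of objects, arrows and
   functors is strict (Leibniz) throughout, as the pullbacks of categories and
   the equations between functors below are strict. *)
From Stdlib Require Import ProofIrrelevance FinFun.

Set Implicit Arguments.
Unset Strict Implicit.
Unset Printing Implicit Defensive.

Declare Scope cat_scope.
Delimit Scope cat_scope with cat.
Open Scope cat_scope.

Record category := Category {
  obj :> Type;
  hom : obj -> obj -> Type;
  idm : forall a, hom a a;
  cmp : forall a b c, hom b c -> hom a b -> hom a c;
  cmp_idl : forall a b (f : hom a b), cmp (idm b) f = f;
  cmp_idr : forall a b (f : hom a b), cmp f (idm a) = f;
  cmp_assoc : forall a b c d (h : hom c d) (g : hom b c) (f : hom a b),
    cmp h (cmp g f) = cmp (cmp h g) f
}.
Arguments hom {c} a b : rename.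
Arguments idm {c} a : rename.
Arguments cmp {c a b c0} g f : rename.

Notation "g ∘ f" := (cmp g f) (at level 40, left associativity) : cat_scope.

(* Equality of arrows whose endpoints are only propositionally equal:
   [same_arrow f g] forces the endpoints, and then the arrows, to coincide. *)
Inductive same_arrow (C : category) (a b : C) (f : hom a b) :
    forall a' b' : C, hom a' b' -> Prop :=
  same_arrow_refl : same_arrow f f.

Lemma same_arrow_idm (C : category) (a b : C) :
  a = b -> same_arrow (idm a) (idm b).
Proof. intros e; destruct e; constructor. Qed.

Lemma same_arrow_inv (C : category) (a b a' b' : C)
    (f : hom a b) (f' : hom a' b') :
  same_arrow f f' ->
  exists (ea : a = a') (eb : b = b'),
    eq_rect b (hom a') (eq_rect a (fun x => hom x b) f a' ea) b' eb = f'.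
Proof. intros e; destruct e; exists eq_refl, eq_refl; reflexivity. Qed.

Lemma same_arrow_cmp (C : category) (a b c a' b' c' : C)
    (g : hom b c) (f : hom a b) (g' : hom b' c') (f' : hom a' b') :
  same_arrow g g' -> same_arrow f f' -> same_arrow (g ∘ f) (g' ∘ f').
Proof.
intros eg ef.
destruct (same_arrow_inv eg) as [eb [ec Eg]].
destruct (same_arrow_inv ef) as [ea [eb' Ef]].
destruct ea, ec, eb; rewrite (proof_irrelevance _ eb' eq_refl) in Ef.
simpl in Eg, Ef; subst; constructor.
Qed.

Record functor (C D : category) := Functor {
  fob :> C -> D;
  fmap : forall a b : C, hom a b -> hom (fob a) (fob b);
  fmap_idm : forall a : C, fmap (idm a) = idm (fob a);
  fmap_cmp : forall (a b c : C) (g : hom b c) (f : hom a b),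
    fmap (g ∘ f) = fmap g ∘ fmap f
}.
Arguments fmap {C D} F {a b} f : rename.

Definition id_functor (C : category) : functor C C :=
  @Functor C C (fun a => a) (fun _ _ f => f)
    (fun _ => eq_refl) (fun _ _ _ _ _ => eq_refl).

Program Definition comp_functor (C D E : category)
    (G : functor D E) (F : functor C D) : functor C E :=
  @Functor C E (fun a => G (F a)) (fun a b f => fmap G (fmap F f)) _ _.
Next Obligation. now rewrite !fmap_idm. Qed.
Next Obligation. now rewrite !fmap_cmp. Qed.

Notation "G ⊚ F" := (comp_functor G F)
  (at level 40, left associativity) : cat_scope.

Lemma functor_eq (C D : category) (F G : functor C D) :
  F = G -> forall (a b : C) (f : hom a b), same_arrow (fmap F f) (fmap G f).
Proof. intros e; destruct e; constructor. Qed.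

Record nat_trans (C D : category) (F G : functor C D) := NatTrans {
  component :> forall a : C, hom (F a) (G a);
  naturality : forall (a b : C) (f : hom a b),
    component b ∘ fmap F f = fmap G f ∘ component a
}.

Record adjunction (C D : category) (L : functor C D) (R : functor D C) :=
Adjunction {
  unit : nat_trans (id_functor C) (R ⊚ L);
  counit : nat_trans (L ⊚ R) (id_functor D);
  triangle_l : forall c : C, counit (L c) ∘ fmap L (unit c) = idm (L c);
  triangle_r : forall d : D, fmap R (counit d) ∘ unit (R d) = idm (R d)
}.

Definition is_terminal (C : category) (t : C) : Prop :=
  forall a : C, exists! f : hom a t, True.

Definition cartesian (E B : category) (p : functor E B)
    (a b : E) (f : hom a b) : Prop :=
  forall (c : E) (g : hom c b) (h : hom (p c) (p a)),
    fmap p f ∘ h = fmap p g ->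
    exists! k : hom c a, fmap p k = h /\ f ∘ k = g.

Definition fibration (E B : category) (p : functor E B) : Prop :=
  forall (b : E) (x : B) (v : hom x (p b)),
    exists (a : E) (f : hom a b), same_arrow (fmap p f) v /\ cartesian p f.

Definition preserves_cartesian (E B E' B' : category)
    (p : functor E B) (p' : functor E' B') (F : functor E E') : Prop :=
  forall (a b : E) (f : hom a b), cartesian p f -> cartesian p' (fmap F f).

Definition is_pullback (P A B C : category)
    (p1 : functor P A) (p2 : functor P B)
    (F : functor A C) (G : functor B C) : Prop :=
  F ⊚ p1 = G ⊚ p2 /\
  forall (T : category) (q1 : functor T A) (q2 : functor T B),
    F ⊚ q1 = G ⊚ q2 ->
    exists! h : functor T P, p1 ⊚ h = q1 /\ p2 ⊚ h = q2.

(* The canonical pullback of categories: pairs of objects, and of arrows,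
   with the same image. *)
Record pb_obj (A B C : category) (F : functor A C) (G : functor B C) :=
PbObj {
  pb_fst : A;
  pb_snd : B;
  pb_eq : F pb_fst = G pb_snd
}.
Arguments PbObj {A B C} F G pb_fst pb_snd pb_eq.

Record pb_hom (A B C : category) (F : functor A C) (G : functor B C)
    (x y : pb_obj F G) := PbHom {
  pbh_fst : hom (pb_fst x) (pb_fst y);
  pbh_snd : hom (pb_snd x) (pb_snd y);
  pbh_eq : same_arrow (fmap F pbh_fst) (fmap G pbh_snd)
}.

Lemma pb_hom_eq (A B C : category) (F : functor A C) (G : functor B C)
    (x y : pb_obj F G) (f g : pb_hom x y) :
  pbh_fst f = pbh_fst g -> pbh_snd f = pbh_snd g -> f = g.
Proof.
destruct f as [f1 f2 ef], g as [g1 g2 eg]; simpl; intros e1 e2.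
destruct e1, e2; f_equal; apply proof_irrelevance.
Qed.

Program Definition pb_cat (A B C : category)
    (F : functor A C) (G : functor B C) : category :=
  @Category (pb_obj F G) (@pb_hom A B C F G)
    (fun x => @PbHom A B C F G x x (idm (pb_fst x)) (idm (pb_snd x)) _)
    (fun x y z g f => @PbHom A B C F G x z
       (pbh_fst g ∘ pbh_fst f) (pbh_snd g ∘ pbh_snd f) _)
    _ _ _.
Next Obligation. rewrite !fmap_idm; apply same_arrow_idm, pb_eq. Qed.
Next Obligation. rewrite !fmap_cmp; apply same_arrow_cmp; apply pbh_eq. Qed.
Next Obligation. apply pb_hom_eq; apply cmp_idl. Qed.
Next Obligation. apply pb_hom_eq; apply cmp_idr. Qed.
Next Obligation. apply pb_hom_eq; apply cmp_assoc. Qed.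

Definition pb_proj1 (A B C : category) (F : functor A C) (G : functor B C) :
    functor (pb_cat F G) A :=
  @Functor (pb_cat F G) A (fun x => pb_fst x) (fun _ _ f => pbh_fst f)
    (fun _ => eq_refl) (fun _ _ _ _ _ => eq_refl).

Definition pb_proj2 (A B C : category) (F : functor A C) (G : functor B C) :
    functor (pb_cat F G) B :=
  @Functor (pb_cat F G) B (fun x => pb_snd x) (fun _ _ f => pbh_snd f)
    (fun _ => eq_refl) (fun _ _ _ _ _ => eq_refl).

(* [pb_pair e] is the functor x |-> (q1 x, q2 x). *)
Program Definition pb_pair (T A B C : category)
    (F : functor A C) (G : functor B C)
    (q1 : functor T A) (q2 : functor T B) (e : F ⊚ q1 = G ⊚ q2) :
    functor T (pb_cat F G) :=
  @Functor T (pb_cat F G)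
    (fun x => PbObj F G (q1 x) (q2 x) (f_equal (fun H => fob H x) e))
    (fun x y f => @PbHom A B C F G _ _ (fmap q1 f) (fmap q2 f)
       (functor_eq e f)) _ _.
Next Obligation. apply pb_hom_eq; apply fmap_idm. Qed.
Next Obligation. apply pb_hom_eq; apply fmap_cmp. Qed.

(* Finite diagrams of categories.  They are indexed by finite graphs rather
   than finite categories: a limit indexed by a category is the limit indexed
   by its underlying graph. *)
Record finite_diagram := FiniteDiagram {
  vertex : Type;
  edge : Type;
  vertex_finite : Finite vertex;
  edge_finite : Finite edge;
  src : edge -> vertex;
  tgt : edge -> vertex;
  at_vertex : vertex -> category;
  along_edge : forall e : edge, functor (at_vertex (src e)) (at_vertex (tgt e))
}.

Definition is_cone (D : finite_diagram) (P : category)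
    (leg : forall v : vertex D, functor P (at_vertex v)) : Prop :=
  forall e : edge D, along_edge e ⊚ leg (src e) = leg (tgt e).

Definition is_limit (D : finite_diagram) (P : category)
    (leg : forall v : vertex D, functor P (at_vertex v)) : Prop :=
  is_cone leg /\
  forall (T : category) (q : forall v : vertex D, functor T (at_vertex v)),
    is_cone q -> exists! h : functor T P, forall v, leg v ⊚ h = q v.

(* Plain dependent type theory. *)
Record pDTT := PDTT {
  ctx : category;
  U : category;
  Udot : category;
  u : functor U ctx;
  udot : functor Udot ctx;
  Sigma : functor Udot U;
  Delta : functor U Udot;
  ctx_terminal : exists t : ctx, is_terminal t;
  u_fib : fibration u;
  udot_fib : fibration udot;
  u_Sigma : u ⊚ Sigma = udot;
  Sigma_Delta : adjunction Sigma Delta;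
  unit_cartesian : forall a : Udot, cartesian udot (unit Sigma_Delta a);
  counit_cartesian : forall A : U, cartesian u (counit Sigma_Delta A);
  Sigma_cartesian : preserves_cartesian udot u Sigma;
  Delta_cartesian : preserves_cartesian u udot Delta
}.
Arguments u {p}.
Arguments udot {p}.
Arguments Sigma {p}.
Arguments Delta {p}.

(* An object [x] lying over [Γ] along [p]. *)
Definition over (C B : category) (p : functor C B) (Γ : B) (x : C) : Prop :=
  p x = Γ.

Definition is_type (T : pDTT) (Γ : ctx T) (A : U T) : Prop := over u Γ A.

Definition is_term (T : pDTT) (Γ : ctx T) (a : Udot T) (A : U T) : Prop :=
  over udot Γ a /\ Sigma a = A.

(* The categories and functors obtained by finite limits from the data of a
   plain dependent type theory: the least class containing that data, closed
   under identities and composition of functors, under finite limits of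
   categories with their projections, and under the functors which the
   universal property of such a limit induces from functors of the class. *)
Inductive generated_cat (T : pDTT) : category -> Prop :=
| gen_ctx : generated_cat T (ctx T)
| gen_U : generated_cat T (U T)
| gen_Udot : generated_cat T (Udot T)
| gen_limit (D : finite_diagram) (P : category)
    (leg : forall v : vertex D, functor P (at_vertex v)) :
    (forall v : vertex D, generated_cat T (at_vertex v)) ->
    (forall e : edge D, generated_functor T (along_edge e)) ->
    is_limit leg -> generated_cat T P
with generated_functor (T : pDTT) : forall C D : category, functor C D -> Prop :=
| gen_u : generated_functor T (@u T)
| gen_udot : generated_functor T (@udot T)
| gen_Sigma : generated_functor T (@Sigma T)
| gen_Delta : generated_functor T (@Delta T)
| gen_id (C : category) :
    generated_cat T C -> generated_functor T (id_functor C)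
| gen_comp (C D E : category) (G : functor D E) (F : functor C D) :
    generated_functor T G -> generated_functor T F ->
    generated_functor T (G ⊚ F)
| gen_leg (D : finite_diagram) (P : category)
    (leg : forall v : vertex D, functor P (at_vertex v)) (v : vertex D) :
    (forall v : vertex D, generated_cat T (at_vertex v)) ->
    (forall e : edge D, generated_functor T (along_edge e)) ->
    is_limit leg -> generated_functor T (leg v)
| gen_induced (D : finite_diagram) (P : category)
    (leg : forall v : vertex D, functor P (at_vertex v))
    (C : category) (h : functor C P) :
    (forall v : vertex D, generated_cat T (at_vertex v)) ->
    (forall e : edge D, generated_functor T (along_edge e)) ->
    is_limit leg -> generated_cat T C ->
    (forall v : vertex D, generated_functor T (leg v ⊚ h)) ->
    generated_functor T h.

(* Extensional Φ-types. *)
Record ext_types (T : pDTT) := ExtTypes {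
  Xcat : category;
  Ycat : category;
  Lambda : functor Xcat Ycat;
  Y_ctx : functor Ycat (ctx T);
  Xcat_gen : generated_cat T Xcat;
  Ycat_gen : generated_cat T Ycat;
  Lambda_gen : generated_functor T Lambda;
  Y_ctx_gen : generated_functor T Y_ctx;
  Phi : functor Ycat (U T);
  Psi : functor Xcat (Udot T);
  Phi_over : u ⊚ Phi = Y_ctx;
  (* includes the commutation Φ Λ = Σ Ψ *)
  Phi_pullback : is_pullback Lambda Psi Phi Sigma
}.
Arguments Lambda {T e}.
Arguments Y_ctx {T e}.
Arguments Phi {T e}.
Arguments Psi {T e}.

Definition X_ctx (T : pDTT) (E : ext_types T) : functor (Xcat E) (ctx T) :=
  Y_ctx ⊚ Lambda.
Arguments X_ctx {T E}.

(* The canonical pullback of Φ and Σ, lying over the contexts through its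
   projection to the category of the Y's. *)
Definition YPhiU (T : pDTT) (E : ext_types T) : category :=
  pb_cat (@Phi T E) Sigma.

Definition YPhiU_ctx (T : pDTT) (E : ext_types T) :
    functor (YPhiU E) (ctx T) :=
  Y_ctx ⊚ pb_proj1 Phi Sigma.
Arguments YPhiU_ctx {T E}.

Definition Lambda_star_Psi (T : pDTT) (E : ext_types T) :
    functor (Xcat E) (YPhiU E) :=
  pb_pair (proj1 (Phi_pullback E)).
Arguments Lambda_star_Psi {T E}.

(* The object (Y, a) of the canonical pullback, for Φ Y = Σ a. *)
Definition YPhiU_pair (T : pDTT) (E : ext_types T)
    (Y : Ycat E) (a : Udot T) (e : Sigma a = Phi Y) : YPhiU E :=
  PbObj Phi Sigma Y a (eq_sym e).

(* Main.v *)
(* Both X and the canonical pullback of Φ and Σ are pullbacks of the same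
   cospan, so each universal property provides a functor between them, and these
   are mutually inverse because the two projections of a pullback are jointly
   monic; [Y⟨a⟩] is the functor into X, η is its compatibility with the projections
   to terms, and β is the instance of η at (ΛX, ΨX). *)
From Stdlib Require Import ProofIrrelevance FunctionalExtensionality.
Require Import Defs.

Set Implicit Arguments.
Unset Strict Implicit.
Unset Printing Implicit Defensive.

Lemma functor_ob_eq (C D : category) (F G : functor C D) :
  F = G -> forall a : C, F a = G a.
Proof. intros e; destruct e; reflexivity. Qed.

(** The endpoint equalities produced by [same_arrow_inv] are loops here, so proof irrelevance makes
    them [eq_refl] and the transports vanish. *)
Lemma same_arrow_eq (C : category) (a b : C) (f g : hom a b) :
  same_arrow f g -> f = g.
Proof.
intros e; destruct (same_arrow_inv e) as [ea [eb E]].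
rewrite (proof_irrelevance _ ea eq_refl), (proof_irrelevance _ eb eq_refl) in E.
exact E.
Qed.

Lemma functor_ext (C D : category) (F G : functor C D) :
  (forall a : C, F a = G a) ->
  (forall (a b : C) (f : hom a b), same_arrow (fmap F f) (fmap G f)) ->
  F = G.
Proof.
destruct F as [Fo Fm Fi Fc], G as [Go Gm Gi Gc]; simpl; intros eo em.
assert (e : Fo = Go) by (apply functional_extensionality; exact eo).
(* With the object maps identified, the arrow maps share one type and [same_arrow] reduces to plain
   equality. *)
destruct e.
assert (e : Fm = Gm).
{ do 3 (apply functional_extensionality_dep; intro).
  apply same_arrow_eq, em. }
destruct e; f_equal; apply proof_irrelevance.
Qed.

(** Both sides compute to the same values on objects and arrows; only their proofs of functoriality
    can differ. *)
Lemma comp_functor_assoc (B C D E : category)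
    (H : functor D E) (G : functor C D) (F : functor B C) :
  H ⊚ (G ⊚ F) = H ⊚ G ⊚ F.
Proof. apply functor_ext; constructor. Qed.

Lemma comp_functor_id_r (C D : category) (F : functor C D) :
  F ⊚ id_functor C = F.
Proof. apply functor_ext; constructor. Qed.

Section CanonicalPullback.

Variables (A B C : category) (F : functor A C) (G : functor B C).

Lemma pb_obj_ext (x y : pb_obj F G) :
  pb_fst x = pb_fst y -> pb_snd x = pb_snd y -> x = y.
Proof.
destruct x as [x1 x2 ex], y as [y1 y2 ey]; simpl; intros e1 e2.
destruct e1, e2; f_equal; apply proof_irrelevance.
Qed.

Lemma pb_same_arrow (x y x' y' : pb_cat F G) (f : hom x y) (f' : hom x' y') :
  same_arrow (pbh_fst f) (pbh_fst f') -> same_arrow (pbh_snd f) (pbh_snd f') ->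
  same_arrow f f'.
Proof.
intros e1 e2.
destruct (same_arrow_inv e1) as [ex1 [ey1 _]].
destruct (same_arrow_inv e2) as [ex2 [ey2 _]].
(* Whole endpoints must be identified before the arrows can be compared componentwise as parallel
   ones. *)
destruct (pb_obj_ext ex1 ex2), (pb_obj_ext ey1 ey2).
assert (e : f = f') by (apply pb_hom_eq; apply same_arrow_eq; assumption).
destruct e; constructor.
Qed.

Lemma pb_proj_comm : F ⊚ pb_proj1 F G = G ⊚ pb_proj2 F G.
Proof.
apply functor_ext; [exact (@pb_eq A B C F G) | intros a b f; exact (pbh_eq f)].
Qed.

Lemma pb_proj_jointly_monic (T : category) (h k : functor T (pb_cat F G)) :
  pb_proj1 F G ⊚ h = pb_proj1 F G ⊚ k ->
  pb_proj2 F G ⊚ h = pb_proj2 F G ⊚ k -> h = k.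
Proof.
intros e1 e2; apply functor_ext.
- intros a; apply pb_obj_ext;
    [exact (functor_ob_eq e1 a) | exact (functor_ob_eq e2 a)].
- intros a b f; apply pb_same_arrow;
    [exact (functor_eq e1 f) | exact (functor_eq e2 f)].
Qed.

Lemma pb_proj1_pair (T : category) (q1 : functor T A) (q2 : functor T B)
    (e : F ⊚ q1 = G ⊚ q2) : pb_proj1 F G ⊚ pb_pair e = q1.
Proof. apply functor_ext; constructor. Qed.

Lemma pb_proj2_pair (T : category) (q1 : functor T A) (q2 : functor T B)
    (e : F ⊚ q1 = G ⊚ q2) : pb_proj2 F G ⊚ pb_pair e = q2.
Proof. apply functor_ext; constructor. Qed.

End CanonicalPullback.

Lemma is_pullback_jointly_monic (P A B C : category)
    (p1 : functor P A) (p2 : functor P B) (F : functor A C) (G : functor B C) :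
  is_pullback p1 p2 F G ->
  forall (T : category) (h k : functor T P),
    p1 ⊚ h = p1 ⊚ k -> p2 ⊚ h = p2 ⊚ k -> h = k.
Proof.
intros [comm univ] T h k e1 e2.
(* Both [h] and [k] mediate the cone obtained by projecting [k], so each equals the unique [l]. *)
destruct (univ T (p1 ⊚ k) (p2 ⊚ k)) as [l [_ uniq]].
{ now rewrite !comp_functor_assoc, comm. }
now rewrite <- (uniq h (conj e1 e2)), <- (uniq k (conj eq_refl eq_refl)).
Qed.

(** The projections of [pb_cat F G] form a cone, which induces [k]; each round trip agrees with the
    identity after both projections. *)
Lemma is_pullback_canonical (P A B C : category)
    (p1 : functor P A) (p2 : functor P B) (F : functor A C) (G : functor B C)
    (pb : is_pullback p1 p2 F G) :
  exists k : functor (pb_cat F G) P,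
    p1 ⊚ k = pb_proj1 F G /\ p2 ⊚ k = pb_proj2 F G /\
    k ⊚ pb_pair (proj1 pb) = id_functor P /\
    pb_pair (proj1 pb) ⊚ k = id_functor (pb_cat F G).
Proof.
destruct (proj2 pb _ _ _ (pb_proj_comm F G)) as [k [[k1 k2] _]].
exists k; repeat split; trivial.
- apply (is_pullback_jointly_monic pb);
    rewrite comp_functor_assoc, comp_functor_id_r.
  + now rewrite k1, pb_proj1_pair.
  + now rewrite k2, pb_proj2_pair.
- apply pb_proj_jointly_monic; rewrite comp_functor_assoc, comp_functor_id_r.
  + now rewrite pb_proj1_pair.
  + now rewrite pb_proj2_pair.
Qed.

Theorem mainTheorem8 (T : pDTT) (E : ext_types T) :
  (* formation *)
  (forall (Γ : ctx T) (Y : Ycat E), over Y_ctx Γ Y -> is_type Γ (Phi Y)) /\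
  (* introduction *)
  (forall (Γ : ctx T) (X : Xcat E), over X_ctx Γ X ->
     is_term Γ (Psi X) (Phi (Lambda X))) /\
  (* elimination *)
  (exists elim : functor (YPhiU E) (Xcat E),
     X_ctx ⊚ elim = YPhiU_ctx /\
     elim ⊚ Lambda_star_Psi = id_functor (Xcat E) /\
     Lambda_star_Psi ⊚ elim = id_functor (YPhiU E) /\
     (* computation, beta *)
     (forall (X : Xcat E) (e : Sigma (Psi X) = Phi (Lambda X)),
        Psi X = Psi (elim (YPhiU_pair e))) /\
     (* computation, eta *)
     (forall (Y : Ycat E) (a : Udot T) (e : Sigma a = Phi Y),
        a = Psi (elim (YPhiU_pair e)))).
Proof.
split; [|split].
- intros Γ Y eY; unfold is_type, over in *.
  rewrite <- eY; exact (functor_ob_eq (Phi_over E) Y).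
- intros Γ X eX; unfold is_term, over, X_ctx in *.
  assert (eS : Sigma (Psi X) = Phi (Lambda X)).
  { symmetry; exact (functor_ob_eq (proj1 (Phi_pullback E)) X). }
  split; [|exact eS].
  (* The context of a term is that of its type, here [Phi (Lambda X)], which lies over the context
     of [Lambda X]. *)
  rewrite <- (functor_ob_eq (u_Sigma T) (Psi X)); simpl.
  rewrite eS, <- eX; exact (functor_ob_eq (Phi_over E) (Lambda X)).
- destruct (is_pullback_canonical (Phi_pullback E))
    as [elim [elim1 [elim2 [elimK Kelim]]]].
  assert (eta : forall (Y : Ycat E) (a : Udot T) (e : Sigma a = Phi Y),
            a = Psi (elim (YPhiU_pair e))).
  { intros Y a e; symmetry; exact (functor_ob_eq elim2 (YPhiU_pair e)). }
  (* β is closed by [eta] at [Lambda X] and [Psi X], the inverse laws by [elimK] and [Kelim]; what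
     remains is that [elim] lies over the contexts. *)
  exists elim; repeat split; trivial.
  unfold X_ctx, YPhiU_ctx.
  rewrite <- comp_functor_assoc; exact (f_equal (comp_functor Y_ctx) elim1).
Qed.
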